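(* Let $0<p\le\infty$ and $\beta>-1/2$. Let $u\in T^p_{\beta+1}$. Then, for a.e. $x\in\mathbb{R}^n$, $$\lim_{t\to0}\Big(\frac1{|W(t,x)|}\int_{W(t,x)}|u(s,y)|^2\,ds\,dy\Big)^{1/2}=0.$$
   Context: $\mathbb{R}^{1+n}_+=(0,\infty)\times\mathbb{R}^n$; $r(B)$ is the radius of a ball $B$; $W(t,x):=(t,2t)\times B(x,t^{1/2})$ is the parabolic Whitney cube at $(t,x)$. Tent spaces: for $0<p<\infty$, $\beta\in\mathbb{R}$, $T^p_\beta$ is the space of measurable $f$ on $\mathbb{R}^{1+n}_+$ with $$\|f\|_{T^p_\beta}:=\Big(\int_{\mathbb{R}^n}\Big(\int_0^\infty\frac1{|B(x,t^{1/2})|}\int_{B(x,t^{1/2})}|t^{-\beta}f(t,y)|^2dy\,dt\Big)^{p/2}dx\Big)^{1/p}<\infty,$$ and $T^\infty_\beta$ is the space of measurable $f$ with $\|f\|_{T^\infty_\beta}:=\sup_B\big(\int_0^{r(B)^2}\frac1{|B|}\int_B|t^{-\beta}f(t,y)|^2dy\,dt\big)^{1/2}<\infty$ (supremum over all balls $B\subset\mathbb{R}^n$). *)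

(* Defs.v *)
From HB Require Import structures.
From mathcomp Require Import all_boot all_order all_algebra complex.
From mathcomp Require Import all_classical all_reals all_analysis.
From mathcomp Require Import measurable_realfun.

Set Implicit Arguments.
Unset Strict Implicit.
Unset Printing Implicit Defensive.

Import Order.TTheory GRing.Theory Num.Theory.
Import numFieldNormedType.Exports.

Local Open Scope classical_set_scope.
Local Open Scope ring_scope.

Notation Rn R n := (n.-tuple (measurableTypeR R)).

(* Lebesgue measure on R^n, by recursion on n: the point mass on R^0, and on
   R^(n+1) the image of the product measure on R * R^n under consRn.
   Its value on boxes is computed in [leb_box]. *)
Definition consRn (R : realType) (n : nat)
  (z : measurableTypeR R * Rn R n) : Rn R n.+1 := [tuple of z.1 :: z.2].

Section leb_step.
Context (R : realType) (n : nat)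
  (mu : {sigma_finite_measure set (Rn R n) -> \bar R}).

Lemma measurable_consRn : measurable_fun setT (@consRn R n).
Proof. exact: measurable_cons. Qed.

HB.instance Definition _ :=
  isMeasurableFun.Build _ _ _ _ (@consRn R n) measurable_consRn.

Definition leb_step : set (Rn R n.+1) -> \bar R :=
  pushforward (@lebesgue_measure R \x mu)%E (@consRn R n).

Let leb_step0 : leb_step set0 = 0%E. Proof. exact: measure0. Qed.

Let leb_step_ge0 A : (0 <= leb_step A)%E. Proof. exact: measure_ge0. Qed.

Let leb_step_sigma_additive : semi_sigma_additive leb_step.
Proof. exact: measure_semi_sigma_additive. Qed.

HB.instance Definition _ := isMeasure.Build _ _ _ leb_step
  leb_step0 leb_step_ge0 leb_step_sigma_additive.

Lemma leb_step_cons (A : set R) (B : set (Rn R n)) :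
  measurable A -> measurable B ->
  leb_step [set y : Rn R n.+1 | A (thead y) /\ B [tuple of behead y]]
  = (lebesgue_measure A * mu B)%E.
Proof.
move=> mA mB; rewrite /leb_step /pushforward -product_measure1E//.
congr (_ _); apply/seteqP; split => -[a y] /=.
  by rewrite theadE (_ : [tuple of _] = y) //; exact: val_inj.
by rewrite theadE (_ : [tuple of _] = y) //; exact: val_inj.
Qed.

Lemma measurable_consn (A : set R) (B : set (Rn R n)) :
  measurable A -> measurable B ->
  measurable [set y : Rn R n.+1 | A (thead y) /\ B [tuple of behead y]].
Proof.
move=> mA mB.
have -> : [set y : Rn R n.+1 | A (thead y) /\ B [tuple of behead y]] =
  [set y : Rn R n.+1 | A (thead y)] `&`
  [set y : Rn R n.+1 | B [tuple of behead y]] by [].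
apply: measurableI.
- rewrite -[X in measurable X]setTI.
  exact: (@measurable_tnth _ (measurableTypeR R) n.+1 ord0).
- rewrite -[X in measurable X]setTI.
  exact: (@measurable_behead _ (measurableTypeR R) n).
Qed.

Let leb_step_sigma_finite : sigma_finite setT leb_step.
Proof.
have /sigma_finiteP[F [UF ndF Ffin]] := sigma_finiteT (@lebesgue_measure R).
have /sigma_finiteP[G [UG ndG Gfin]] := sigma_finiteT mu.
exists (fun i =>
  [set y : Rn R n.+1 | F i (thead y) /\ G i [tuple of behead y]]).
  apply/esym; rewrite -subTset => y _.
  have [i _ Fi] : (\bigcup_i F i) (thead y) by rewrite -UF.
  have [j _ Gj] : (\bigcup_i G i) [tuple of behead y] by rewrite -UG.
  exists (maxn i j) => //; split.
    by move: Fi; apply/subsetPset/ndF/leq_maxl.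
  by move: Gj; apply/subsetPset/ndG/leq_maxr.
move=> i; have [mF Fi] := Ffin i; have [mG Gi] := Gfin i.
split; first exact: measurable_consn.
by rewrite [ltLHS](leb_step_cons mF mG) lte_mul_pinfty// ge0_fin_numE.
Qed.

HB.instance Definition _ :=
  Measure_isSigmaFinite.Build _ _ _ leb_step leb_step_sigma_finite.
End leb_step.

Fixpoint leb (R : realType) (n : nat) :
    {sigma_finite_measure set (Rn R n) -> \bar R} :=
  match n with
  | 0 => \d_([tuple] : Rn R 0)
  | n'.+1 => leb_step (leb R n')
  end.

Lemma leb_box (R : realType) (n : nat) (A : 'I_n -> set R) :
  (forall i, measurable (A i)) ->
  leb R n [set y : Rn R n | forall i, A i (tnth y i)]
  = (\prod_(i < n) lebesgue_measure (A i))%E.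
Proof.
move=> mA.
suff [] : measurable [set y : Rn R n | forall i, A i (tnth y i)] /\
  leb R n [set y : Rn R n | forall i, A i (tnth y i)]
  = (\prod_(i < n) lebesgue_measure (A i))%E by [].
elim: n A mA => [|n IH] A mA.
  rewrite big_ord0 (_ : [set _ | _] = setT); last first.
    by apply/seteqP; split=> // y _ [].
  by split=> //=; rewrite diracT.
pose B := [set y : Rn R n | forall i, A (lift ord0 i) (tnth y i)].
have -> : [set y : Rn R n.+1 | forall i, A i (tnth y i)] =
    [set y : Rn R n.+1 | A ord0 (thead y) /\ B [tuple of behead y]].
  have tb (y : Rn R n.+1) i : tnth [tuple of behead y] i = tnth y (lift ord0 i).
    by rewrite [in RHS](tuple_eta y) tnthS.
  apply/seteqP; split => y /=.
    by move=> Ay; split; [exact: Ay|move=> i; rewrite tb].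
  move=> [A0 By] i; case: (unliftP ord0 i) => [j|] -> //.
  by rewrite -tb; exact: By.
have [mB muB] := IH (A \o lift ord0) (fun i => mA _).
split; first exact: measurable_consn.
by rewrite big_ord_recl -muB -leb_step_cons.
Qed.

Section tent_spaces.
Context (R : realType) (n : nat).

Definition leb1n : set (measurableTypeR R * Rn R n) -> \bar R :=
  (@lebesgue_measure R \x leb R n)%E.

Definition halfspace : set (measurableTypeR R * Rn R n) :=
  `]0, +oo[ `*` setT.

(* Euclidean balls: no norm is available on tuples, and the library's norm on
   row vectors is the sup norm. *)
Definition eball (x : Rn R n) (r : R) : set (Rn R n) :=
  [set y | Num.sqrt (\sum_(i < n) (tnth y i - tnth x i : R) ^+ 2) < r].

(* Lebesgue (not only Borel) measurability: preimages of Borel sets belong to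
   the completion of the Borel sigma-algebra. No Borel representative has to be
   chosen in the integrals below: the library's integral of a nonnegative
   function is a supremum over Borel simple functions lying below it, which for
   a Lebesgue measurable function is its Lebesgue integral. *)
Definition leb_measurable_fun (D : set (measurableTypeR R * Rn R n))
    (f : measurableTypeR R * Rn R n -> R) : Prop :=
  forall Y : set R, measurable Y ->
    completed_algebra_gen leb1n (D `&` f @^-1` Y).

Definition leb_measurable_cfun (D : set (measurableTypeR R * Rn R n))
    (f : measurableTypeR R * Rn R n -> R[i]) : Prop :=
  leb_measurable_fun D (fun z => complex.Re (f z)) /\
  leb_measurable_fun D (fun z => complex.Im (f z)).

Local Open Scope ereal_scope.

Definition weighted_sq (beta : R) (f : measurableTypeR R * Rn R n -> R[i])
    (t : R) (y : Rn R n) : \bar R :=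
  (((t `^ (- beta)) * Normc.normc (f (t, y))) ^+ 2)%R%:E.

(* The value at [p = -oo] is junk. *)
Definition tent_norm (p : \bar R) (beta : R)
    (f : measurableTypeR R * Rn R n -> R[i]) : \bar R :=
  match p with
  | q%:E =>
    (\int[leb R n]_x
       (\int[lebesgue_measure]_(t in `]0%R, +oo[)
          ((leb R n (eball x (Num.sqrt t)))^-1 *
           \int[leb R n]_(y in eball x (Num.sqrt t)) weighted_sq beta f t y))
       `^ (q / 2)) `^ q^-1
  | +oo =>
    ereal_sup [set
      (\int[lebesgue_measure]_(t in `]0%R, (b.2 ^+ 2)%R[)
         ((leb R n (eball b.1 b.2))^-1 *
          \int[leb R n]_(y in eball b.1 b.2) weighted_sq beta f t y)) `^ 2^-1
      | b in [set b : Rn R n * R | (0 < b.2)%R]]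
  | -oo => 0
  end.

Definition tent_space (p : \bar R) (beta : R) :
    set (measurableTypeR R * Rn R n -> R[i]) :=
  [set f | leb_measurable_cfun halfspace f /\ tent_norm p beta f < +oo].

Definition whitney (t : R) (x : Rn R n) : set (measurableTypeR R * Rn R n) :=
  `]t, (2 * t)%R[ `*` eball x (Num.sqrt t).

Definition whitney_avg (u : measurableTypeR R * Rn R n -> R[i])
    (t : R) (x : Rn R n) : \bar R :=
  ((leb1n (whitney t x))^-1 *
   \int[leb1n]_(z in whitney t x) (Normc.normc (u z) ^+ 2)%:E) `^ 2^-1.

End tent_spaces.

(* Main.v *)
Require Import Defs.
From HB Require Import structures.
From mathcomp Require Import all_boot all_order all_algebra complex.
From mathcomp Require Import all_classical all_reals all_analysis.
From mathcomp Require Import measurable_realfun lra ring.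

Import Order.TTheory GRing.Theory Num.Theory.
Import numFieldNormedType.Exports.

Local Open Scope classical_set_scope.
Local Open Scope ring_scope.
Import HBNNSimple.

(** Why the average vanishes in the limit.  On the Whitney box over (t, x) the
weight s^(-2(beta+1)) is at least (2t)^(-2(beta+1)), and the box has volume
comparable to t |B(x, t^(1/2))|.  The mean of |u|^2 over the box is therefore
at most a constant times
  t^(2 beta + 1) * |B(x, t^(1/2))|^(-1)
    * (integral over the box of |s^(-(beta+1)) u(s, y)|^2).
The last two factors together are bounded uniformly in t, for almost every x:
- if p is finite, by the conical square function at x, since B(x, t^(1/2)) lies
  in B(x, s^(1/2)) for s in (t, 2t); the square function is finite almost
  everywhere because a power of it has a finite integral
  ([local_mass_le_cone_energy], [cone_energy_le]);
- if p is infinite, at every x, by the Carleson functional of the ball of radius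
  (2t)^(1/2) centred at x ([local_mass_le_carleson]).
As 2 beta + 1 > 0, the power of t tends to 0.

Two technical points shape the argument.  First, u is only Lebesgue measurable,
so the partial functions and the square function of u need not be Borel.  The
integral is defined as a supremum over simple functions for every nonnegative
function, hence it is monotone without any measurability
([le_integral_subset]); only upper bounds for u are wanted, so |u| can be
replaced by a Borel function m <= |u| agreeing with |u| off a Borel null set
([normc_borel_minorant]).  The tent norm does not increase, the Whitney averages are
not diminished ([le_integral_null]), and the Tonelli theorem applies to m.  Secondly,
the volume of Euclidean balls enters only up to constants, so balls are compared
with inscribed and circumscribed cubes, and in the square function the factor
|B(x, s^(1/2))|^(-1) is weakened to the inverse volume of a cube, which does not
depend on x. *)

(** * Integrals of nonnegative, possibly non-measurable functions *)

(** Every simple function below the restriction of [f] to [D] is also below the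
restriction of [g] to [E]; neither integrand has to be measurable. *)
Lemma le_integral_subset d (T : measurableType d) (R : realType)
    (mu : {measure set T -> \bar R}) (D E : set T) (f g : T -> \bar R) :
  D `<=` E -> (forall x, D x -> 0 <= f x)%E -> (forall x, E x -> 0 <= g x)%E ->
  (forall x, D x -> f x <= g x)%E ->
  (\int[mu]_(x in D) f x <= \int[mu]_(x in E) g x)%E.
Proof.
move=> DE f0 g0 fg; rewrite !ge0_integralE//.
apply: ge_ereal_sup => _ [h /= hf <-]; apply: ereal_sup_ubound.
exists h => //= x; apply: le_trans (hf x) _; rewrite !patchE.
case: ifPn => [/set_mem Dx|_]; first by rewrite mem_set ?fg//; exact: DE.
by case: ifPn => [/set_mem /g0|].
Qed.

(** Only [g] is measurable: a simple function below [f] is below [g] almost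
everywhere, and for such a pair of measurable functions null sets are harmless. *)
Lemma le_integral_null d (T : measurableType d) (R : realType)
    (mu : {measure set T -> \bar R}) (D N : set T) (f g : T -> \bar R) :
  measurable D -> measurable N -> mu N = 0%E ->
  (forall x, D x -> 0 <= f x)%E -> (forall x, D x -> 0 <= g x)%E ->
  measurable_fun D g ->
  (forall x, D x -> ~ N x -> f x <= g x)%E ->
  (\int[mu]_(x in D) f x <= \int[mu]_(x in D) g x)%E.
Proof.
move=> mD mN N0 f0 g0 mg fg; rewrite ge0_integralE//.
apply: ge_ereal_sup => _ [h /= hf <-].
rewrite -integralT_nnsfun (integral_mkcond D).
apply: ae_ge0_le_integral => //.
- by move=> x _; rewrite lee_fin; exact: fun_ge0.
- exact/measurable_EFinP.
- by move=> x _; exact: erestrict_ge0.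
- exact/(measurable_restrictT _ _).1.
exists N; split=> // x /= /not_implyP[_ hx]; apply: contrapT => Nx.
apply: hx; apply: le_trans (hf x) _; rewrite !patchE.
by case: ifPn => // /set_mem Dx; exact: fg.
Qed.

(** * Euclidean balls and cubes *)

Section balls.
Context {R : realType} {n : nat}.
Implicit Types (x y : Rn R n) (r : R).

Definition cube x r : set (Rn R n) :=
  [set y | forall i, `]tnth x i - r, tnth x i + r[%classic (tnth y i)].

Lemma lebesgue_measure_sym_itv (a r : R) : 0 <= r ->
  lebesgue_measure (`]a - r, a + r[%classic : set R) = (2 * r)%:E.
Proof.
move=> r0; rewrite lebesgue_measure_itv/= lte_fin -EFinB.
case: ifPn => [_|]; first by congr (_%:E); lra.
by rewrite -leNgt => ar; congr (_%:E); lra.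
Qed.

Lemma leb_cube x r : 0 <= r -> leb R n (cube x r) = ((2 * r) ^+ n)%:E.
Proof.
move=> r0.
rewrite /cube (@leb_box _ _ (fun i => `]tnth x i - r, tnth x i + r[%classic))//.
under eq_bigr => i _ do rewrite lebesgue_measure_sym_itv//.
by rewrite prodEFin prodr_const card_ord.
Qed.

Lemma measurable_cube x r : measurable (cube x r).
Proof.
have -> : cube x r = \bigcap_(i in [set: 'I_n])
    (fun y : Rn R n => tnth y i) @^-1` `]tnth x i - r, tnth x i + r[.
  by apply/seteqP; split => y /= H i; [move=> _; exact: H|exact: (H i I)].
apply: fin_bigcap_measurable => // i _; rewrite -[X in measurable X]setTI.
exact: (@measurable_tnth _ (measurableTypeR R) n i).
Qed.

Definition edistance x y : R := Num.sqrt (\sum_(i < n) (tnth y i - tnth x i) ^+ 2).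

Lemma measurable_edistance :
  measurable_fun setT (fun z : Rn R n * Rn R n => edistance z.1 z.2).
Proof.
apply: (@measurableT_comp _ _ _ _ _ _ (@Num.sqrt R)).
  exact: (continuous_measurable_fun (@sqrt_continuous R)).
apply: measurable_sum => i; apply: measurable_funX.
apply: measurable_funB.
- exact: (measurableT_comp (@measurable_tnth _ (measurableTypeR R) n i) measurable_snd).
- exact: (measurableT_comp (@measurable_tnth _ (measurableTypeR R) n i) measurable_fst).
Qed.

Lemma measurable_eball x r : measurable (eball x r).
Proof.
have -> : eball x r = setT `&` (edistance x) @^-1` `]-oo, r[.
  by rewrite setTI; apply/seteqP; split => y; rewrite /= in_itv.
have m : measurable_fun setT (edistance x).
  exact: (measurable_fun_pair2 x measurable_edistance).
exact: m.
Qed.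

Lemma eball_sub_cube x r : eball x r `<=` cube x r.
Proof.
move=> y yr i /=; rewrite in_itv/= -ltr_distlC distrC.
apply: le_lt_trans yr; rewrite -sqrtr_sqr; apply: ler_wsqrtr.
rewrite (bigD1 i)//= lerDl; apply: sumr_ge0 => j _; exact: sqr_ge0.
Qed.

(** The half-side is divided by the square root of [n.+1] rather than [n]: this
makes the inequality strict and avoids a division by zero in dimension 0. *)
Lemma cube_sub_eball x r : 0 < r ->
  cube x (r / Num.sqrt n.+1%:R) `<=` eball x r.
Proof.
move=> r0 y yr; rewrite /eball/=.
rewrite -[ltRHS](ger0_norm (ltW r0)) -sqrtr_sqr ltr_sqrt ?exprn_gt0//.
have le i : (tnth y i - tnth x i : R) ^+ 2 <= r ^+ 2 / n.+1%:R.
  have := yr i; rewrite /= in_itv/= -ltr_distlC distrC => /ltW yi.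
  rewrite -real_normK ?num_real// -[X in _ / X]sqr_sqrtr// -expr_div_n.
  by rewrite ler_sqr ?nnegrE// divr_ge0// ?sqrtr_ge0// ltW.
apply: le_lt_trans (ler_sum _ (fun i _ => le i)) _.
rewrite sumr_const card_ord -[_ *+ n]mulr_natr -mulrA gtr_pMr ?exprn_gt0//.
by rewrite mulrC ltr_pdivrMr ?mul1r ?ltr_nat.
Qed.

Lemma leb_eball_le x r : 0 <= r -> (leb R n (eball x r) <= ((2 * r) ^+ n)%:E)%E.
Proof.
move=> r0; rewrite -(leb_cube x _)//; apply: le_measure; rewrite ?inE.
- exact: measurable_eball.
- exact: measurable_cube.
- exact: eball_sub_cube.
Qed.

Lemma leb_eball_ge x r : 0 < r ->
  (((2 * (r / Num.sqrt n.+1%:R)) ^+ n)%:E <= leb R n (eball x r))%E.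
Proof.
move=> r0; rewrite -(leb_cube x _); last by rewrite divr_ge0// ?sqrtr_ge0// ltW.
apply: le_measure; rewrite ?inE.
- exact: measurable_cube.
- exact: measurable_eball.
- exact: cube_sub_eball.
Qed.

Lemma invr_le_inv_leb_eball x r : 0 < r ->
  ((((2 * r) ^+ n)^-1)%:E <= (leb R n (eball x r))^-1)%E.
Proof.
move=> r0; have := leb_eball_le x r (ltW r0).
have h : 0 < (2 * r) ^+ n by rewrite exprn_gt0// mulr_gt0.
have : (0 <= leb R n (eball x r))%E by exact: measure_ge0.
case: (leb R n (eball x r)) => //= s.
rewrite !lee_fin => s0 sr; rewrite inver; case: ifPn => [_|sn0]; first by rewrite leey.
by rewrite lee_fin lef_pV2// posrE lt_neqAle eq_sym sn0 s0.
Qed.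

Lemma sub_eball x r s : r <= s -> eball x r `<=` eball x s.
Proof. by move=> rs y; rewrite /eball/= => /lt_le_trans; exact. Qed.

End balls.

(** * Borel minorant of a Lebesgue measurable function *)

(** The preimages of the countably many half-lines with rational endpoint, and
[D] itself, are Borel up to null sets; one Borel null set [N] covers all these
exceptional sets, and rational half-lines determine measurability. *)
Lemma completed_borel_off_null d (T : measurableType d) (R : realType)
    (mu : {measure set T -> \bar R}) (D : set T) (f : T -> R) :
  (forall Y, measurable Y -> completed_algebra_gen mu (D `&` f @^-1` Y)) ->
  exists N, [/\ measurable N, mu N = 0%E, measurable (D `\` N) &
    measurable_fun (D `\` N) f].
Proof.
move=> fD.
(* Quantifying over all Borel N containing M lets the countably many exceptional
   sets be merged. *)
have sep Y : measurable Y -> exists M, [/\ measurable M, mu M = 0%E &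
    forall N, M `<=` N -> measurable N -> measurable ((D `&` f @^-1` Y) `\` N)].
  move=> mY; have [A mA [B [M [mM M0 BM]] AB]] := fD _ mY.
  exists M; split=> // N MN mN.
  rewrite -AB setDUl (_ : B `\` N = set0) ?setU0; first exact: measurableD.
  by rewrite -subset0 => x [/BM /MN].
have [M0 [mM0 M00 hM0]] := sep _ measurableT.
have /choice[M hM] : forall q : rat, exists M, [/\ measurable M, mu M = 0%E &
    forall N, M `<=` N -> measurable N ->
      measurable ((D `&` f @^-1` `]ratr q, +oo[) `\` N)].
  by move=> q; apply: sep.
pose N := M0 `|` \bigcup_q M q.
have mN : measurable N.
  by apply: measurableU => //; apply: bigcupT_measurable_rat => q; case: (hM q).
have mDN : measurable (D `\` N).
  by have := hM0 N (@subsetUl _ _ _) mN; rewrite preimage_setT setIT.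
exists N; split => //.
  apply/negligibleP => //; apply: negligibleU; first exact/negligibleP.
  apply: (@negligibleS _ _ _ _
    (\bigcup_k (if unpickle k is Some q then M q else set0))).
    by move=> x [q _ Mq]; exists (pickle q); [exact: I|rewrite pickleK].
  apply: negligible_bigcup => k; case: unpickle => [q|]; last exact: negligible_set0.
  by case: (hM q) => mq q0 _; exact/negligibleP.
apply: (measurability _ (RGenOInfty.measurableE R)) => _ [_ [a ->] <-].
have -> : (D `\` N) `&` f @^-1` `]a, +oo[ = \bigcup_(q in [set q : rat | a < ratr q])
    ((D `&` f @^-1` `]ratr q, +oo[) `\` N).
  apply/seteqP; split => [x [[Dx Nx]] /=|x [q /= aq [[Dx /=] fq Nx]]].
    rewrite in_itv/= andbT => /rat_in_itvoo[q]; rewrite in_itv/= => /andP[aq qf].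
    by exists q => //; split=> //; split=> //=; rewrite in_itv/= qf.
  split=> //=; move: fq; rewrite !in_itv/= !andbT; exact: lt_trans.
rewrite bigcup_mkcond; apply: bigcupT_measurable_rat => q.
case: ifPn => // _; case: (hM q) => _ _; apply => // x Mx.
by right; exists q.
Qed.

Lemma normcE (R : rcfType) (c : R[i]) :
  Normc.normc c = Num.sqrt (complex.Re c ^+ 2 + complex.Im c ^+ 2).
Proof. by case: c. Qed.

(** The minorant is [|u|] set to 0 outside the part of the half-space where the
real and imaginary parts of [u] are Borel. *)
Lemma normc_borel_minorant (R : realType) (n : nat)
    (u : measurableTypeR R * Rn R n -> R[i]) :
  leb_measurable_cfun (@halfspace R n) u ->
  exists (m : measurableTypeR R * Rn R n -> R) N,
    [/\ measurable_fun setT m, forall z, 0 <= m z <= Normc.normc (u z),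
        measurable N, (@lebesgue_measure R \x leb R n)%E N = 0%E &
        forall z, halfspace z -> ~ N z -> m z = Normc.normc (u z)].
Proof.
case=> /completed_borel_off_null[N1 [mN1 N10 mD1 m1]].
move=> /completed_borel_off_null[N2 [mN2 N20 mD2 m2]].
pose N := N1 `|` N2; pose S := @halfspace R n `\` N.
have mS : measurable S by rewrite /S /N setDUr; exact: measurableI.
have mu_S : measurable_fun S (fun z => Normc.normc (u z)).
  have -> : (fun z => Normc.normc (u z)) = fun z =>
      Num.sqrt (complex.Re (u z) ^+ 2 + complex.Im (u z) ^+ 2).
    by apply/funext => z; exact: normcE.
  apply: (@measurableT_comp _ _ _ _ _ _ (@Num.sqrt R)).
    exact: (continuous_measurable_fun (@sqrt_continuous R)).
  apply: measurable_funD; apply: measurable_funX.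
  - by apply: measurable_funS m1 => //; rewrite /S /N setDUr => x [].
  - by apply: measurable_funS m2 => //; rewrite /S /N setDUr => x [].
exists ((fun z => Normc.normc (u z)) \_ S), N; split.
- by apply/(measurable_restrictT _ mS).
- move=> z; rewrite patchE; have : 0 <= Normc.normc (u z) by rewrite normcE sqrtr_ge0.
  by case: ifPn => _ ->; rewrite lexx.
- exact: measurableU.
- by apply/negligibleP; [exact: measurableU|apply: negligibleU; exact/negligibleP].
- by move=> z hz Nz; rewrite patchE mem_set.
Qed.

(** * Iterated integrals over rectangles *)

Section rectangles.
Context d1 d2 (T1 : measurableType d1) (T2 : measurableType d2) (R : realType).
Variables (m1 : {sigma_finite_measure set T1 -> \bar R})
  (m2 : {sigma_finite_measure set T2 -> \bar R}).
Variables (f : T1 * T2 -> \bar R) (A : set T1) (B : set T2).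
Hypotheses (mf : measurable_fun setT f) (f0 : forall z, (0 <= f z)%E).
Hypotheses (mA : measurable A) (mB : measurable B).

Lemma measurable_integral_section :
  measurable_fun setT (fun s => \int[m2]_(y in B) f (s, y))%E.
Proof.
have mTB : measurable ([set: T1] `*` B) by exact: measurableX.
have mfB : measurable_fun setT (f \_ (setT `*` B)).
  by apply/(measurable_restrictT _ mTB); exact: measurable_funTS.
have /(_ m2) := measurable_fun_fubini_tonelli_F _ mfB.
rewrite (_ : fubini_F _ _ = fun s => \int[m2]_(y in B) f (s, y))%E.
  by apply => z; apply: erestrict_ge0.
apply/funext => s; rewrite /fubini_F [RHS]integral_mkcond.
by apply: eq_integral => y _; rewrite !patchE in_setX in_setT/=.
Qed.

Lemma integral_rectangle :
  (\int[m1 \x m2]_(z in A `*` B) f z =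
   \int[m1]_(s in A) \int[m2]_(y in B) f (s, y))%E.
Proof.
have mAB : measurable (A `*` B) by exact: measurableX.
rewrite integral_mkcond fubini_tonelli1; first last.
- by move=> z; apply: erestrict_ge0.
- by apply/(measurable_restrictT _ mAB); exact: measurable_funTS.
rewrite [RHS]integral_mkcond; apply: eq_integral => s _.
rewrite /fubini_F patchE; case: ifPn => sA.
  rewrite [RHS]integral_mkcond; apply: eq_integral => y _.
  by rewrite !patchE in_setX sA.
by apply: integral0_eq => y _; rewrite patchE in_setX (negbTE sA).
Qed.
End rectangles.

(** * Conical energy *)

Section moving_balls.
Context {R : realType} {n : nat} (g : measurableTypeR R * Rn R n -> R).
Hypotheses (mg : measurable_fun setT g) (g0 : forall z, 0 <= g z).

Definition ball_mass (x : Rn R n) (s : measurableTypeR R) : \bar R :=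
  (\int[leb R n]_(y in eball x (Num.sqrt s)) (g (s, y))%:E)%E.

Lemma ball_mass_ge0 x s : (0 <= ball_mass x s)%E.
Proof. by apply: integral_ge0 => y _; rewrite lee_fin. Qed.

(** Joint measurability in the centre and in the time: the ball mass is a section
integral over the Borel set of the triples (x, s, y) with y in the ball. *)
Lemma measurable_ball_mass :
  measurable_fun setT (fun z : Rn R n * measurableTypeR R => ball_mass z.1 z.2).
Proof.
pose E := [set w : (Rn R n * measurableTypeR R) * Rn R n |
  eball w.1.1 (Num.sqrt w.1.2) w.2].
pose k := (fun w : (Rn R n * measurableTypeR R) * Rn R n =>
  (g (w.1.2, w.2))%:E) \_ E.
have mE : measurable E.
  pose h (w : (Rn R n * measurableTypeR R) * Rn R n) :=
    Num.sqrt (w.1.2 : R) - edistance w.1.1 w.2.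
  have -> : E = setT `&` h @^-1` `]0, +oo[.
    rewrite setTI; apply/seteqP; split => w;
      by rewrite /E/= in_itv/= andbT subr_gt0.
  have mh : measurable_fun setT h.
    apply: measurable_funB.
      apply: (@measurableT_comp _ _ _ _ _ _ (@Num.sqrt R)).
        exact: (continuous_measurable_fun (@sqrt_continuous R)).
      exact: (measurableT_comp measurable_snd measurable_fst).
    apply: (@measurableT_comp _ _ _ _ _ _ (fun z : Rn R n * Rn R n => edistance z.1 z.2)
      _ (fun w => (w.1.1, w.2)) measurable_edistance).
    apply: measurable_fun_pair; last exact: measurable_snd.
    exact: (measurableT_comp measurable_fst measurable_fst).
  exact: mh.
have mk : measurable_fun setT k.
  apply/(measurable_restrictT _ mE); apply: measurable_funTS.
  apply/measurable_EFinP; apply: (measurableT_comp mg).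
  apply: measurable_fun_pair; last exact: measurable_snd.
  exact: (measurableT_comp measurable_snd measurable_fst).
have k0 w : (0 <= k w)%E by apply: erestrict_ge0 => z _; rewrite lee_fin.
have := @measurable_fun_fubini_tonelli_F _ _ _ _ _ (leb R n) _ mk k0.
congr measurable_fun; apply/funext => -[x s].
rewrite /fubini_F /ball_mass [RHS]integral_mkcond.
apply: eq_integral => y _; rewrite /k !patchE.
have -> : ((x, s, y) \in E) = (y \in eball x (Num.sqrt s)) by [].
by [].
Qed.

(** The inverse volume of the cube circumscribed about a ball of radius
[Num.sqrt s], as a real power so that its measurability is immediate. *)
Definition box_weight (s : R) : R := (2 * Num.sqrt s) `^ (- n%:R).

Lemma box_weightE s : 0 < s -> box_weight s = ((2 * Num.sqrt s) ^+ n)^-1.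
Proof.
move=> s0; rewrite /box_weight powRN powR_mulrn// mulr_ge0 ?sqrtr_ge0//.
Qed.

Lemma measurable_box_weight : measurable_fun setT box_weight.
Proof.
apply: (@measurableT_comp _ _ _ _ _ _ ((@powR R)^~ _)).
  exact: measurable_powR.
apply: measurable_funM; first exact: measurable_cst.
exact: (continuous_measurable_fun (@sqrt_continuous R)).
Qed.

Lemma measurable_weighted_ball_mass :
  measurable_fun setT (fun z : Rn R n * measurableTypeR R =>
    (box_weight z.2)%:E * ball_mass z.1 z.2)%E.
Proof.
apply: emeasurable_funM; last exact: measurable_ball_mass.
apply/measurable_EFinP; exact: (measurableT_comp measurable_box_weight measurable_snd).
Qed.

(** The square of the conical square function, with balls normalised by the
volume of the circumscribed cube. *)
Definition cone_energy x : \bar R :=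
  (\int[lebesgue_measure]_(s in `]0%R, +oo[)
     ((box_weight s)%:E * ball_mass x s))%E.

Lemma weighted_ball_mass_ge0 x s : (0 <= (box_weight s)%:E * ball_mass x s)%E.
Proof. by rewrite mule_ge0 ?ball_mass_ge0// lee_fin powR_ge0. Qed.

Lemma measurable_cone_energy : measurable_fun setT cone_energy.
Proof.
have := @measurable_integral_section _ _ _ _ _
  (@lebesgue_measure R) _ `]0%R, +oo[%classic measurable_weighted_ball_mass
  (fun z => weighted_ball_mass_ge0 z.1 z.2).
by apply.
Qed.

Lemma cone_energy_ge0 x : (0 <= cone_energy x)%E.
Proof. by apply: integral_ge0 => s _; exact: weighted_ball_mass_ge0. Qed.

(** For s in (t, 2t) the ball of radius [Num.sqrt t] lies in that of radius
[Num.sqrt s], and the weight at s is at least the weight at 2t. *)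
Lemma local_mass_le_cone_energy x t : 0 < t ->
  (\int[lebesgue_measure]_(s in `]t, (2 * t)%R[)
    \int[leb R n]_(y in eball x (Num.sqrt t)) (g (s, y))%:E
   <= ((2 * Num.sqrt (2 * t)) ^+ n)%:E * cone_energy x)%E.
Proof.
move=> t0.
have mx : measurable_fun setT (fun s => (box_weight s)%:E * ball_mass x s)%E.
  exact: (measurable_fun_pair2 x measurable_weighted_ball_mass).
have C0 : 0 < 2 * Num.sqrt (2 * t) by rewrite mulr_gt0// sqrtr_gt0 mulr_gt0.
rewrite -ge0_integralZl//; first last.
- by move=> s _; exact: weighted_ball_mass_ge0.
- exact: measurable_funTS.
apply: le_integral_subset => [s|s _|s _|s].
- by rewrite /= !in_itv/= andbT => /andP[ts _]; exact: lt_trans ts.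
- by apply: integral_ge0 => y _; rewrite lee_fin.
- by rewrite mule_ge0 ?weighted_ball_mass_ge0// lee_fin exprn_ge0// ltW.
rewrite /= in_itv/= => /andP[ts st].
have s0 : 0 < s by exact: lt_trans ts.
apply: (@le_trans _ _ (ball_mass x s)).
  apply: le_integral_subset => [|y _|y _|y _]; rewrite ?lee_fin//.
  by apply: sub_eball; rewrite ler_sqrt// ltW.
rewrite muleA -EFinM -[leLHS]mul1e; apply: lee_pmul => //.
  exact: ball_mass_ge0.
have D0 : 0 < 2 * Num.sqrt s by rewrite mulr_gt0// sqrtr_gt0.
rewrite lee_fin box_weightE// ler_pdivlMr ?exprn_gt0// mul1r.
rewrite lerXn2r ?nnegrE ?(ltW C0) ?(ltW D0)//.
by rewrite ler_pM2l// ler_sqrt ?mulr_ge0// ltW.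
Qed.
End moving_balls.

(** * Energy of Whitney boxes under a finite tent norm *)

Section local_energy.
Context {R : realType} {n : nat} (gamma : R).
Variables (u : measurableTypeR R * Rn R n -> R[i])
  (m : measurableTypeR R * Rn R n -> R).
Hypotheses (mm : measurable_fun setT m)
  (m_le_u : forall z, 0 <= m z <= Normc.normc (u z)).

Definition weighted_minorant (z : measurableTypeR R * Rn R n) : R :=
  ((z.1 : R) `^ (- gamma) * m z) ^+ 2.

Let g := weighted_minorant.

Lemma weighted_minorant_ge0 z : 0 <= g z.
Proof. exact: sqr_ge0. Qed.

Lemma measurable_weighted_minorant : measurable_fun setT g.
Proof.
apply: measurable_funX; apply: measurable_funM => //.
apply: (@measurableT_comp _ _ _ _ _ _ ((@powR R)^~ _)).
  exact: measurable_powR.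
exact: measurable_fst.
Qed.

Lemma weighted_minorant_le s y : ((g (s, y))%:E <= weighted_sq gamma u s y)%E.
Proof.
have /andP[m0 mle] := m_le_u (s, y).
rewrite lee_fin lerXn2r ?nnegrE ?mulr_ge0 ?powR_ge0//=; last first.
  by apply: ler_wpM2l; rewrite ?powR_ge0.
exact: le_trans mle.
Qed.

Lemma weighted_sq_ge0 s y : (0 <= weighted_sq gamma u s y)%E.
Proof. by rewrite lee_fin sqr_ge0. Qed.

(** The volume of a ball is at most that of the circumscribed cube, so the
normalisation by cubes gives the smaller quantity. *)
Lemma cone_energy_le x :
  (cone_energy g x <= \int[lebesgue_measure]_(s in `]0%R, +oo[)
     ((leb R n (eball x (Num.sqrt s)))^-1 *
      \int[leb R n]_(y in eball x (Num.sqrt s)) weighted_sq gamma u s y))%E.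
Proof.
apply: le_integral_subset => // s.
- move=> _; apply: weighted_ball_mass_ge0; exact: weighted_minorant_ge0.
- move=> _; apply: mule_ge0; first by rewrite inve_ge0 measure_ge0.
  by apply: integral_ge0 => y _; exact: weighted_sq_ge0.
rewrite /= in_itv/= andbT => s0; apply: lee_pmul.
- by rewrite lee_fin powR_ge0.
- by apply: ball_mass_ge0; exact: weighted_minorant_ge0.
- by rewrite box_weightE//; apply: invr_le_inv_leb_eball; rewrite sqrtr_gt0.
apply: le_integral_subset => // y _; [|exact: weighted_sq_ge0|].
  by rewrite lee_fin weighted_minorant_ge0.
exact: weighted_minorant_le.
Qed.

(** The ball of radius r = [Num.sqrt (2 * t)] is chosen so that its Carleson box,
of height r^2 = 2t, contains the Whitney box. *)
Lemma local_mass_le_carleson x t : 0 < t ->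
  (\int[lebesgue_measure]_(s in `]t, (2 * t)%R[)
    \int[leb R n]_(y in eball x (Num.sqrt t)) (g (s, y))%:E
   <= ((2 * Num.sqrt (2 * t)) ^+ n)%:E *
      \int[lebesgue_measure]_(s in `]0%R, (Num.sqrt (2 * t) ^+ 2)%R[)
        ((leb R n (eball x (Num.sqrt (2 * t))))^-1 *
         \int[leb R n]_(y in eball x (Num.sqrt (2 * t))) weighted_sq gamma u s y))%E.
Proof.
move=> t0; set r := Num.sqrt (2 * t).
have r0 : 0 < r by rewrite sqrtr_gt0 mulr_gt0.
have C0 : 0 < (2 * r) ^+ n by rewrite exprn_gt0// mulr_gt0.
have g0 := weighted_minorant_ge0.
set phi := fun s => (\int[leb R n]_(y in eball x (Num.sqrt t)) (g (s, y))%:E)%E.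
have phi0 s : (0 <= phi s)%E by apply: integral_ge0 => y _; rewrite lee_fin.
have mphi : measurable_fun setT phi.
  apply: (@measurable_integral_section _ _ _ _ _ (leb R n) (EFin \o g)).
  - by apply/measurable_EFinP; exact: measurable_weighted_minorant.
  - by move=> z; rewrite lee_fin.
  - exact: measurable_eball.
(* Insert 1 = C * C^-1 with C the volume of the cube circumscribed about the ball
   of radius r, then move C^-1 under the integral. *)
rewrite -[leLHS]mul1e -[X in (X%:E * _)%E](divff (lt0r_neq0 C0)) EFinM -muleA.
apply: lee_pmul => //; first by rewrite lee_fin ltW.
  apply: mule_ge0; first by rewrite lee_fin invr_ge0 ltW.
  by apply: integral_ge0 => s _; exact: phi0.
rewrite -ge0_integralZl_EFin//; [|by move=> s _; exact: phi0|
  exact: measurable_funTS|by rewrite invr_ge0 ltW].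
apply: le_integral_subset => s.
- by rewrite /= !in_itv/= sqr_sqrtr ?mulr_ge0// ?ltW// => /andP[/(lt_trans t0)-> ->].
- move=> _; apply: mule_ge0; first by rewrite lee_fin invr_ge0 ltW.
  exact: phi0.
- move=> _; apply: mule_ge0; first by rewrite inve_ge0 measure_ge0.
  by apply: integral_ge0 => y _; exact: weighted_sq_ge0.
move=> _; apply: lee_pmul; [by rewrite lee_fin invr_ge0 ltW|exact: phi0| |].
  exact: invr_le_inv_leb_eball.
apply: le_integral_subset => y.
- by apply: sub_eball; rewrite ler_sqrt ?mulr_ge0// ?ler_peMl// ?ler1n// ltW.
- by move=> _; rewrite lee_fin.
- by move=> _; exact: weighted_sq_ge0.
- by move=> _; exact: weighted_minorant_le.
Qed.

(** The one place where the finiteness of the tent norm is used.  For finite [p] a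
power of the cone energy of the minorant is Borel with finite integral, so the
cone energy is finite almost everywhere; for infinite [p] the square of the norm
is a bound at every point. *)
Lemma local_energy_bound (p : \bar R) : (0 < p)%E ->
  (tent_norm p gamma u < +oo)%E ->
  {ae leb R n, forall x, exists2 M : R, 0 <= M & forall t, 0 < t ->
    (\int[lebesgue_measure]_(s in `]t, (2 * t)%R[)
      \int[leb R n]_(y in eball x (Num.sqrt t)) (g (s, y))%:E
     <= (M * (2 * Num.sqrt (2 * t)) ^+ n)%:E)%E}.
Proof.
have C0 t : 0 <= (2 * Num.sqrt (2 * t)) ^+ n.
  by rewrite exprn_ge0// mulr_ge0// sqrtr_ge0.
have g0 := weighted_minorant_ge0.
have mg := measurable_weighted_minorant.
case: p => [q| |]//=; last first.
  set N := ereal_sup _ => _ Noo.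
  have N0 : (0 <= N)%E.
    apply: le_trans (ereal_sup_ubound _); last first.
      by exists (nseq_tuple n 0, 1); [exact: ltr01|reflexivity].
    exact: poweR_ge0.
  have Nfin : (N `^ 2)%E \is a fin_num by rewrite fin_num_poweR// ge0_fin_numE.
  apply: aeW => x; exists (fine (N `^ 2)%E); first by rewrite fine_ge0 ?poweR_ge0.
  move=> t t0; apply: le_trans (local_mass_le_carleson x t t0) _.
  rewrite [fine _ * _]mulrC EFinM fineK//; set X := (X in (_ * X)%E).
  have X0 : (0 <= X)%E.
    apply: integral_ge0 => s _; apply: mule_ge0; first by rewrite inve_ge0 measure_ge0.
    by apply: integral_ge0 => y _; exact: weighted_sq_ge0.
  apply: lee_pmul; [by rewrite lee_fin; exact: C0|exact: X0|by []|].
  (* The norm bounds the square root of X, so X = (X `^ 2^-1) `^ 2 is at most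
     its square. *)
  rewrite -[leLHS]poweRe1// -[X in (_ `^ X <= _)%E](@mulVf _ 2)// poweRrM.
  apply: gt0_ler_poweR => //; rewrite ?in_itv/= ?leey ?andbT ?poweR_ge0//.
  apply: ereal_sup_ubound; exists (x, Num.sqrt (2 * t)) => //=.
  by rewrite sqrtr_gt0 mulr_gt0.
rewrite lte_fin => q0 /lty_poweRy.
rewrite invr_neq0 ?gt_eqF// => /(_ isT) Aoo.
have mH : measurable_fun setT (cone_energy g) by exact: measurable_cone_energy.
have H0 x : (0 <= cone_energy g x)%E by exact: cone_energy_ge0.
suff /(integrable_ae measurableT) :
    (leb R n).-integrable setT (fun x => cone_energy g x `^ (q / 2))%E.
  apply: filterS => x /(_ I).
  rewrite ge0_fin_numE ?poweR_ge0// => /lty_poweRy.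
  rewrite mulf_neq0 ?invr_neq0 ?gt_eqF// => /(_ isT) Hx.
  have Hfin : cone_energy g x \is a fin_num by rewrite ge0_fin_numE.
  exists (fine (cone_energy g x)); first by rewrite fine_ge0.
  move=> t t0; rewrite [fine _ * _]mulrC EFinM fineK//.
  exact: local_mass_le_cone_energy.
apply/integrableP; split.
  by apply: (measurableT_comp (measurable_poweR _)).
apply: le_lt_trans Aoo.
under eq_integral do rewrite gee0_abs ?poweR_ge0//.
apply: le_integral_subset => // x _; rewrite ?poweR_ge0//.
apply: gt0_ler_poweR; rewrite ?in_itv/= ?leey ?andbT//.
- by rewrite divr_ge0// ltW.
- apply: integral_ge0 => s _; apply: mule_ge0; first by rewrite inve_ge0 measure_ge0.
  by apply: integral_ge0 => y _; exact: weighted_sq_ge0.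
exact: cone_energy_le.
Qed.
End local_energy.

(** * Whitney averages *)

Section whitney_bound.
Context {R : realType} {n : nat} (gamma : R).
Variables (u : measurableTypeR R * Rn R n -> R[i])
  (m : measurableTypeR R * Rn R n -> R) (N : set (measurableTypeR R * Rn R n)).
Hypotheses (gamma0 : 0 <= gamma) (mm : measurable_fun setT m)
  (m_le_u : forall z, 0 <= m z <= Normc.normc (u z))
  (mN : measurable N) (N0 : (@lebesgue_measure R \x leb R n)%E N = 0%E)
  (muN : forall z, halfspace z -> ~ N z -> m z = Normc.normc (u z)).

Lemma measurable_whitney t (x : Rn R n) : measurable (whitney t x).
Proof. by apply: measurableX => //; exact: measurable_eball. Qed.

Lemma whitney_sub_halfspace t (x : Rn R n) : 0 < t ->
  whitney t x `<=` @halfspace R n.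
Proof.
move=> t0 [s y] [/=]; rewrite in_itv/= => /andP[ts _] _.
by split => //=; rewrite in_itv/= andbT; exact: lt_trans ts.
Qed.

Lemma leb1n_whitney_ge t (x : Rn R n) : 0 < t ->
  ((t * (2 * (Num.sqrt t / Num.sqrt n.+1%:R)) ^+ n)%:E <= leb1n (whitney t x))%E.
Proof.
move=> t0; rewrite /leb1n/= product_measure1E//; last exact: measurable_eball.
have mI : lebesgue_measure (`]t, (2 * t)[%classic : set R) = t%:E.
  rewrite lebesgue_measure_itv/= lte_fin ltr_pMl// ltr1n -EFinB.
  by congr (_%:E); lra.
rewrite EFinM; apply: lee_pmul; last 2 first.
- by rewrite -mI.
- by apply: leb_eball_ge; rewrite sqrtr_gt0.
- by rewrite lee_fin ltW.
- by rewrite lee_fin exprn_ge0// mulr_ge0// divr_ge0// sqrtr_ge0.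
Qed.

(** As [gamma >= 0], the inverse of the weight increases with time, so on the
Whitney box it is at most its value at [2 * t]. *)
Lemma minorant_sq_le s y t : 0 < s -> s < 2 * t ->
  m (s, y) ^+ 2 <= ((2 * t) `^ gamma) ^+ 2 * weighted_minorant gamma m (s, y).
Proof.
move=> s0 st; rewrite /weighted_minorant -exprMn mulrA.
have /andP[m0 _] := m_le_u (s, y).
rewrite lerXn2r ?nnegrE ?mulr_ge0 ?powR_ge0//=.
rewrite ler_peMl//.
apply: (@le_trans _ _ (s `^ gamma * s `^ (- gamma))).
  by rewrite powRN mulfV// gt_eqF// powR_gt0.
apply: ler_wpM2r; first exact: powR_ge0.
by apply: ge0_ler_powR; rewrite ?nnegrE// ?ltW// (lt_trans s0).
Qed.

(** Here [|u|] is exchanged for its Borel minorant, after which the integral over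
the box can be iterated. *)
Lemma integral_whitney_le t (x : Rn R n) : 0 < t ->
  (\int[@leb1n R n]_(z in whitney t x) (Normc.normc (u z) ^+ 2)%:E <=
   (((2 * t) `^ gamma) ^+ 2)%:E *
   \int[lebesgue_measure]_(s in `]t, (2 * t)%R[)
     \int[leb R n]_(y in eball x (Num.sqrt t))
        (weighted_minorant gamma m (s, y))%:E)%E.
Proof.
move=> t0; set g := weighted_minorant gamma m.
have mg : measurable_fun setT (EFin \o g).
  by apply/measurable_EFinP; exact: measurable_weighted_minorant.
have g0 z : (0 <= (EFin \o g) z)%E by rewrite lee_fin weighted_minorant_ge0.
have mW := measurable_whitney t x.
apply: (@le_trans _ _
    (\int[@lebesgue_measure R \x leb R n]_(z in whitney t x) (m z ^+ 2)%:E)%E).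
  apply: (@le_integral_null _ _ _ (@lebesgue_measure R \x leb R n)%E _ N) => //.
  - by move=> z _; rewrite lee_fin sqr_ge0.
  - by move=> z _; rewrite lee_fin sqr_ge0.
  - apply: measurable_funTS; apply/measurable_EFinP; exact: measurable_funX.
  - by move=> z /(whitney_sub_halfspace _ _ t0) hz Nz; rewrite muN.
rewrite -(@integral_rectangle _ _ _ _ _ (@lebesgue_measure R) (leb R n)
  (EFin \o g))//; last exact: measurable_eball.
rewrite -ge0_integralZl_EFin//; last 2 first.
- exact: measurable_funTS.
- exact: sqr_ge0.
apply: le_integral_subset => // -[s y].
- by rewrite lee_fin sqr_ge0.
- by move=> _; apply: mule_ge0; rewrite ?g0// lee_fin sqr_ge0.
move=> [/=]; rewrite in_itv/= => /andP[ts st] _.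
by rewrite lee_fin minorant_sq_le// (lt_trans t0).
Qed.

(** The volume ratio of the cube circumscribed about the ball of radius
[Num.sqrt (2 * t)] and the cube of [cube_sub_eball] inside the ball of radius
[Num.sqrt t]. *)
Definition whitney_const : R := (Num.sqrt 2 * Num.sqrt n.+1%:R) ^+ n.

(** With [gamma = beta + 1] the bound under the root is a constant times
[t `^ (2 * beta + 1)]: the volume of the balls has cancelled. *)
Lemma whitney_avg_le t (x : Rn R n) (M : R) : 0 < t -> 0 <= M ->
  (\int[lebesgue_measure]_(s in `]t, (2 * t)%R[)
     \int[leb R n]_(y in eball x (Num.sqrt t))
        (weighted_minorant gamma m (s, y))%:E
     <= (M * (2 * Num.sqrt (2 * t)) ^+ n)%:E)%E ->
  (whitney_avg u t x <=
   ((whitney_const * M * ((2 * t) `^ gamma) ^+ 2 / t) `^ 2^-1)%:E)%E.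
Proof.
move=> t0 M0 HM; rewrite /whitney_avg.
have /= := integral_whitney_le t x t0; set I := (X in (X <= _)%E) => HI.
have I0 : (0 <= I)%E by apply: integral_ge0 => z _; rewrite lee_fin sqr_ge0.
have J0 : (0 <= \int[lebesgue_measure]_(s in `]t, (2 * t)%R[)
    \int[leb R n]_(y in eball x (Num.sqrt t))
      (weighted_minorant gamma m (s, y))%:E)%E.
  apply: integral_ge0 => s _; apply: integral_ge0 => y _.
  by rewrite lee_fin weighted_minorant_ge0.
have := leb1n_whitney_ge t x t0; set W := leb1n _; set a := (X in X%:E) => aW.
have a0 : 0 < a.
  by rewrite /a mulr_gt0// exprn_gt0// mulr_gt0// divr_gt0// sqrtr_gt0.
have Wa : (W^-1 <= (a^-1)%:E)%E.
  case: W aW => //= [w|_]; last by rewrite invey lee_fin invr_ge0 ltW.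
  rewrite lee_fin => aw.
  have w0 : 0 < w by exact: lt_le_trans aw.
  by rewrite inver gt_eqF// lee_fin lef_pV2.
have W0 : (0 <= W^-1)%E.
  by rewrite inve_ge0; apply: le_trans aW; rewrite lee_fin ltW.
rewrite -[leRHS]poweR_EFin.
refine (gt0_ler_poweR (r := 2^-1) _ _ _ _); first by rewrite invr_ge0.
- by rewrite in_itv/= leey andbT mule_ge0.
- rewrite in_itv/= leey andbT lee_fin.
  by rewrite !mulr_ge0 ?exprn_ge0 ?sqrtr_ge0 ?powR_ge0 ?invr_ge0// ltW.
apply: le_trans (lee_pmul W0 I0 Wa HI) _.
set K := ((2 * t) `^ gamma) ^+ 2.
have K0 : 0 <= K by exact: sqr_ge0.
apply: (@le_trans _ _ ((a^-1)%:E * (K%:E * (M * (2 * Num.sqrt (2 * t)) ^+ n)%:E))%E).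
  apply: lee_pmul; rewrite ?lee_fin ?invr_ge0 ?(ltW a0)//.
    by apply: mule_ge0; rewrite ?lee_fin//; exact: J0.
  by apply: lee_pmul; rewrite ?lee_fin//; exact: J0.
rewrite -!EFinM lee_fin le_eqVlt; apply/orP; left; apply/eqP.
have -> : (2 * Num.sqrt (2 * t)) ^+ n = whitney_const * (a / t).
  rewrite /a mulrAC divff ?gt_eqF// mul1r /whitney_const -exprMn; congr (_ ^+ _).
  rewrite sqrtrM//; field; rewrite gt_eqF// sqrtr_gt0 ltr0n//.
field.
by rewrite !gt_eqF.
Qed.
End whitney_bound.

(** * Convergence of the averages *)

Theorem lemma5p3 (R : realType) (n : nat) (p : \bar R) (beta : R)
    (u : measurableTypeR R * Rn R n -> R[i]) :
  (0 < p)%E -> - 2^-1 < beta ->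
  tent_space p (beta + 1) u ->
  {ae leb R n, forall x, whitney_avg u t x @[t --> 0^'+] --> 0%E}.
Proof.
move=> p0 hb [/normc_borel_minorant[m [N [mm mu mN N0 muN]]] tu].
have gamma0 : 0 <= beta + 1 by lra.
have := local_energy_bound _ u m mm mu p p0 tu.
apply: filterS => x [M M0 HM].
pose c := whitney_const (R := R) (n := n) * M * (2 `^ (beta + 1)) ^+ 2.
have c0 : 0 <= c.
  by rewrite /c !mulr_ge0 ?exprn_ge0 ?mulr_ge0 ?sqrtr_ge0 ?powR_ge0.
apply: (@squeeze_cvge _ _ _ _ (cst 0%E) _
  (fun t => (c `^ 2^-1 * t `^ (beta + 2^-1))%:E)).
- near=> t; have t0 : 0 < t by near: t; exact: nbhs_right_gt.
  apply/andP; split; first exact: poweR_ge0.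
  apply: le_trans (whitney_avg_le _ u m N gamma0 mm mu mN N0 muN t x M t0 M0 (HM t t0)) _.
  (* Both sides agree: c collects the factors that do not depend on t, and
     (t^(beta+1))^2 / t = t^(2 beta + 1). *)
  rewrite lee_fin le_eqVlt; apply/orP; left; apply/eqP.
  have -> : beta + 2^-1 = (2 * beta + 1) * 2^-1 by lra.
  rewrite powRrM -powRM ?powR_ge0//; congr (_ `^ _).
  rewrite /c powRM// ?ltW// exprMn.
  have -> : t `^ (2 * beta + 1) = (t `^ (beta + 1)) ^+ 2 / t.
    rewrite -powR_mulrn ?powR_ge0// -powRrM -[X in _ / X]powRr1 ?ltW//.
    rewrite -powRN -powRD; last by apply/implyP => _; rewrite gt_eqF.
    by congr (_ `^ _); lra.
  by rewrite !mulrA.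
- exact: cvg_cst.
- apply: cvg_EFin; first by near=> t.
  have : c `^ 2^-1 * t `^ (beta + 2^-1) @[t --> 0^'+] --> c `^ 2^-1 * 0.
    by apply: cvgM; [exact: cvg_cst|apply: powR_cvg0; lra].
  by rewrite mulr0.
Unshelve. all: by end_near.
Qed.
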